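(* Let $\Delta^n$ be an $n$-dimensional simplex with a given triangulation, and let $V$ be the set of vertices of this triangulation. If $V$ is colored with $n$ colors (i.e. a function $f: V \to \{1,\ldots,n\}$ is given), then there exists a connected monochromatic subgraph that intersects every codimension $1$ face of $\Delta^n$.
   Context: An $n$-simplex $\Delta^n$ is the convex hull of $n+1$ affinely independent points in a Euclidean space; its codimension $1$ faces are the convex hulls of $n$ of these points. A triangulation is a finite collection $T$ of simplices whose union is $\Delta^n$, closed under taking faces, such that any two distinct members intersect in a common face or in the empty set. The graph in question is the $1$-skeleton of the triangulation: its vertices are the elements of $V$ and its edges are the $1$-simplices of the triangulation. A subgraph is monochromatic if all its vertices have the same color. *)

(* Defs.v *)
From mathcomp Require Import all_boot all_order all_algebra.
From mathcomp Require Import boolp classical_sets functions cardinality reals.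
From mathcomp Require Import convex.

Set Implicit Arguments.
Unset Strict Implicit.
Unset Printing Implicit Defensive.

Import Order.TTheory GRing.Theory Num.Theory.
Local Open Scope classical_set_scope.
Local Open Scope ring_scope.

Section Geometry.
Variables (R : realType) (d : nat).
Implicit Types (A F S D : set 'rV[R]_d) (T : set (set 'rV[R]_d)).

Definition convex_hull A : set 'rV[R]_d :=
  smallest (@convex_set R 'rV[R]_d) A.

Definition affinely_independent (k : nat) (q : 'I_k -> 'rV[R]_d) : Prop :=
  forall a : 'I_k -> R,
    \sum_i a i = 0 -> \sum_i a i *: q i = 0 -> forall i, a i = 0.

(* The convex hull of the points q i for i in J; J = [set: 'I_k] gives the
   whole simplex spanned by q. *)
Definition spanned_face (k : nat) (q : 'I_k -> 'rV[R]_d) (J : {set 'I_k}) :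
  set 'rV[R]_d := convex_hull (q @` [set` J]).

Definition is_simplex (k : nat) S : Prop :=
  exists q : 'I_k.+1 -> 'rV[R]_d,
    affinely_independent q /\ S = convex_hull (range q).

(* Faces are nonempty: the empty set is not a simplex here. *)
Definition is_face F S : Prop :=
  exists k (q : 'I_k.+1 -> 'rV[R]_d) (J : {set 'I_k.+1}),
    [/\ affinely_independent q, S = convex_hull (range q),
        (0 < #|J|)%N & F = spanned_face q J].

Definition is_triangulation T D : Prop :=
  [/\ finite_set T,
      (forall S, T S -> exists k, is_simplex k S),
      \bigcup_(S in T) S = D,
      (forall S F, T S -> is_face F S -> T F) &
      (forall S S', T S -> T S' -> S <> S' ->
         S `&` S' = set0 \/ (is_face (S `&` S') S /\ is_face (S `&` S') S'))].

(* The 0-simplices of T are singletons. *)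
Definition vertices T : set 'rV[R]_d := [set v | T [set v]].

(* Adjacency in the 1-skeleton. *)
Definition edge T (u v : 'rV[R]_d) : Prop :=
  u <> v /\ T (convex_hull [set u; v]).

End Geometry.

(* (W, F) is a subgraph of the simple graph (V, E); F need not contain every
   edge of E between members of W. *)
Definition is_subgraph (U : Type) (V : set U) (E : U -> U -> Prop)
    (W : set U) (F : rel U) : Prop :=
  [/\ W `<=` V, symmetric F & forall u v, F u v -> [/\ W u, W v & E u v]].

Definition is_connected (U : Type) (W : set U) (F : rel U) : Prop :=
  W !=set0 /\
  forall u v, W u -> W v -> exists s : seq U, path F u s /\ last u s = v.

Definition is_monochromatic (U C : Type) (f : U -> C) (W : set U) : Prop :=
  forall u v, W u -> W v -> f u = f v.

(* Main.v *)
Require Import Defs.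
From mathcomp Require Import all_boot all_order all_algebra.
From mathcomp Require Import boolp classical_sets functions cardinality reals.
From mathcomp Require Import interval_inference convex.
From mathcomp Require Import filter topology normedtype sequences.
From mathcomp Require Import fintype finset.

Set Implicit Arguments.
Unset Strict Implicit.
Unset Printing Implicit Defensive.

(** The theorem reduces to Sperner's lemma. Suppose that every connected
    component of every color class misses some facet of the simplex, and label
    each vertex v by (the index of) a facet missed by its component. Since v
    itself is off that facet, this is a Sperner labelling, so some simplex of
    the triangulation carries all n+1 labels ([sperner]). Only n colors are
    available, so two of its vertices with different labels share a color; they
    are adjacent, hence lie in the same component and have the same label, a
    contradiction.

    The usual proof of Sperner's lemma counts doors between adjacent simplices,
    which for a geometric triangulation requires knowing that an interior
    (n-1)-simplex lies in exactly two n-simplices. That incidence fact is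
    avoided here. The parity argument is made on a purely combinatorial object,
    Scarf's lemma for a finite set X with one ranking for each index i
    ([scarf]), and is then transported to an arbitrary triangulation by a
    compactness argument:

    - if no simplex of T carries all labels, each point x of the big simplex
      gets an index i missing from a simplex of T that contains x;
    - [scarf], applied to the points of the big simplex with coordinates in
      (1/N)Z, ranked by their barycentric coordinates and colored by these
      missing indices, gives a set C of indices and for each k in C a grid point
      colored k, all of them O(1/N)-close to each other and to the face spanned
      by C ([grid_cluster]);
    - along an ultrafilter, C and the simplices involved are constant and the
      points converge ([sperner_limit]), to a point x of the face C that lies,
      for each k in C, in a simplex of T without the label k;
    - a vertex v of T that contributes to x belongs to every simplex of T
      containing x ([common_support]) and to the face C, so its label is some k
      in C by the Sperner condition, yet v is in the simplex without label k. *)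

(** * Pivoting among dominant sets *)

Section Pivot.
Variables (I Y : finType) (r : I -> Y -> nat) (col : Y -> I) (k0 : I).
Hypothesis r_inj : forall i, injective (r i).
Implicit Types (s t : {set Y}).

(** Scarf's notion: no element of Y exceeds the minimum of r i over s for all i
    at once. With r i the i-th barycentric coordinate, no point lies strictly
    inside the subsimplex cut out by the minimal coordinates of s. *)
Definition dominant s := [forall y, exists i, forall x in s, r i y <= r i x].

Lemma dominantP s :
  reflect (forall y, exists i, forall x, x \in s -> r i y <= r i x) (dominant s).
Proof.
apply: (iffP forallP) => H y.
  by have /existsP[i /forall_inP Hi] := H y; exists i.
by have [i Hi] := H y; apply/existsP; exists i; apply/forall_inP.
Qed.

Lemma dominantS s t : s \subset t -> dominant t -> dominant s.
Proof.
move=> /subsetP st /dominantP H; apply/dominantP => y.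
by have [i Hi] := H y; exists i => x /st; apply: Hi.
Qed.

Definition cofacets t := [set y | (y \notin t) && dominant (y |: t)].

Section OrderMin.
Variables (t : {set Y}) (y0 : Y).
Hypothesis y0t : y0 \in t.

Definition order_min i := [arg min_(x < y0 in t) r i x].

Lemma order_min_in i : order_min i \in t.
Proof. by rewrite /order_min; case: arg_minnP. Qed.

Lemma order_min_le i x : x \in t -> r i (order_min i) <= r i x.
Proof. by rewrite /order_min; case: arg_minnP => // j _; apply. Qed.

(** Dominance at the point x of t itself yields a ranking in which x is
    the lowest point of t; this is why a dominant set has at most #|I| elements. *)
Lemma order_min_surj : dominant t -> order_min @: I = t.
Proof.
move=> /dominantP dt; apply/eqP; rewrite eqEsubset; apply/andP; split.
  by apply/subsetP => _ /imsetP[i _ ->]; apply: order_min_in.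
apply/subsetP => x xt; have [i Hi] := dt x.
apply/imsetP; exists i => //; apply: (@r_inj i); apply/eqP.
by rewrite eqn_leq Hi ?order_min_in// order_min_le.
Qed.
End OrderMin.

Section Wall.
Variables (t : {set Y}) (y0 : Y).
Hypotheses (y0t : y0 \in t) (dt : dominant t) (card_t : #|t|.+1 = #|I|).

Let m := order_min t y0.

(** The points that could be added to t to become the new minimum for e while
    leaving the other minima alone. *)
Definition above e := [set y | [forall j, (j != e) ==> (r j (m j) < r j y)]].

Lemma aboveP e y :
  reflect (forall j, j != e -> r j (m j) < r j y) (y \in above e).
Proof. by rewrite inE; apply: (iffP forallP) => H j; apply/implyP/H. Qed.

Definition top_above e := [set y in above e | [forall z in above e, r e z <= r e y]].

Lemma top_aboveP e y :
  reflect (y \in above e /\ forall z, z \in above e -> r e z <= r e y)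
          (y \in top_above e).
Proof.
rewrite [X in reflect _ X]in_set; apply: (iffP andP) => -[ya H]; split=> //.
  exact/forall_inP.
exact/forall_inP.
Qed.

Lemma card_top_above e : above e != set0 -> #|top_above e| = 1.
Proof.
case/set0Pn => z ze; have [y ye ymax] := arg_maxnP (r e) ze.
apply/eqP/cards1P; exists y; apply/setP => x; rewrite inE.
apply/top_aboveP/eqP => [[xe xmax]|->].
  by apply: (@r_inj e); apply/eqP; rewrite eqn_leq xmax ?andbT //; exact: ymax.
by split.
Qed.

(** There is one more index than there are points in t, so exactly one pair of
    indices shares its minimum. *)
Lemma shared_min : exists a b,
  [/\ a != b, m a = m b, {in [set~ a] &, injective m} & {in [set~ b] &, injective m}].
Proof.
have surj : m @: I = t by apply: order_min_surj.
have /injectivePn[a [b ab mab]] : ~~ injectiveb m.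
  apply/injectiveP => /(card_imset I); rewrite surj => E.
  by move: card_t; rewrite E => /eqP; rewrite -[X in _ == X]addn0 -addn1 eqn_add2l.
have inj c d : c != d -> m c = m d -> {in [set~ c] &, injective m}.
  move=> cd mcd; apply/imset_injP; rewrite cardsC1 -card_t /= -surj.
  apply/eqP; congr #|pred_of_set _|; apply/setP => x; apply/imsetP/imsetP.
    by move=> [i _ ->]; exists i.
  case=> i _ ->; have [->|ic] := eqVneq i c; last by exists i; rewrite ?inE.
  by exists d; rewrite ?inE// eq_sym.
exists a, b; split=> //; first exact: (inj a b).
by apply: (inj b a); rewrite 1?eq_sym.
Qed.

(** When a point y completes t, minima become a bijection from I to y |: t, so
    y must take over one of the two indices that shared their minimum, and
    dominance forces it to be the highest candidate for that index. *)
Lemma cofacetsE a b : a != b -> m a = m b ->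
    {in [set~ a] &, injective m} -> {in [set~ b] &, injective m} ->
  cofacets t = top_above a :|: top_above b.
Proof.
move=> ab mab inja injb.
have surj e : e \in [set a; b] -> forall x, x \in t -> exists2 i, i != e & x = m i.
  move=> eab x; rewrite -(order_min_surj y0t dt) => /imsetP[i _ ->].
  have [->|] := eqVneq i e; last by exists i.
  move: eab; rewrite !inE => /orP[]/eqP->; first by exists b; rewrite 1?eq_sym.
  by exists a.
apply/setP => y; rewrite in_setU; apply/idP/orP.
  rewrite inE => /andP[yt dyt].
  have y1 : y \in y |: t by rewrite setU11.
  pose m' := order_min (y |: t) y.
  have surj' : m' @: I = y |: t by apply: order_min_surj.
  have /imset_injP inj0 : #|m' @: I| == #|I| by rewrite surj' cardsU1 yt add1n card_t.
  have inj' : injective m' by move=> i j; apply: inj0.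
  (* e is the index that y takes over *)
  have [e _ me] : exists2 e, e \in I & y = m' e by apply/imsetP; rewrite surj'.
  have m't j : j != e -> m' j \in t.
    move=> je; have := order_min_in y1 j; rewrite -/m' in_setU1 => /orP[/eqP E|//].
    by move: je; rewrite (inj' j e) ?eqxx// E.
  have mE j : j != e -> m' j = m j.
    move=> je; apply: (@r_inj j); apply/eqP; rewrite eqn_leq.
    apply/andP; split; last exact/(order_min_le y0t)/m't.
    by apply: (order_min_le y1); apply/setU1r/order_min_in.
  have ye : y \in above e.
    apply/aboveP => j je; rewrite ltn_neqAle; apply/andP; split.
      apply: contraNneq yt => /r_inj <-; exact: order_min_in.
    by rewrite -mE //; apply: (order_min_le y1).
  have ytop : y \in top_above e.
    apply/top_aboveP; split=> // z /aboveP ze.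
    have /dominantP/(_ z)[i Hi] := dyt.
    have [Ei|ie] := eqVneq i e; first by rewrite -Ei; apply: Hi.
    by have := ze i ie; rewrite ltnNge Hi // setU1r // order_min_in.
  have [<-|ae] := eqVneq e a; first by left.
  have [<-|be] := eqVneq e b; first by right.
  by move: ab; rewrite (inj' a b) ?eqxx// !mE // eq_sym.
have aux e : e \in [set a; b] -> y \in top_above e -> y \in cofacets t.
  move=> eab /top_aboveP[/aboveP ye ymax]; rewrite inE; apply/andP; split.
    apply/negP => /(surj e eab)[i ie E].
    by have := ye i ie; rewrite E ltnn.
  apply/dominantP => z; have [ze|] := boolP (z \in above e).
    exists e => x; rewrite in_setU1 => /orP[/eqP->|xt]; first exact: ymax.
    have /dominantP/(_ y)[i Hi] := dt.
    have [Ei|ie] := eqVneq i e.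
      by rewrite -Ei in ymax *; apply: leq_trans (Hi x xt); apply: ymax; rewrite Ei.
    by have := ye i ie; rewrite ltnNge Hi // order_min_in.
  rewrite inE negb_forall => /existsP[j]; rewrite negb_imply -leqNgt => /andP[je zj].
  exists j => x; rewrite in_setU1 => /orP[/eqP->|xt].
    exact: leq_trans zj (ltnW (ye j je)).
  exact: leq_trans zj (order_min_le y0t j xt).
by case; apply: aux; rewrite !inE eqxx ?orbT.
Qed.

(** The counterpart of the fact that an interior (n-1)-simplex of a
    triangulation lies in two n-simplices. The two completions differ, since a
    point above t for both indices would exceed the minimum of t in every
    ranking. *)
Lemma card_cofacets_interior :
  (forall e, above e != set0) -> #|cofacets t| = 2.
Proof.
move=> above_neq0; have [a [b [ab mab inja injb]]] := shared_min.
rewrite (cofacetsE ab mab inja injb) cardsU !card_top_above //.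
rewrite (_ : _ :&: _ = set0) ?cards0 //; apply/setP => y; rewrite !in_setI in_set0.
apply/negP => /andP[/top_aboveP[/aboveP ya _] /top_aboveP[/aboveP yb _]].
have /dominantP/(_ y)[i Hi] := dt.
have : r i y <= r i (m i) by apply: Hi; apply: order_min_in.
rewrite leqNgt; have [ia|ia] := eqVneq i a; last by rewrite ya.
by rewrite yb // ia.
Qed.
End Wall.


(** Rooms and doors of the classical proof of Sperner's lemma: rooms are the
    maximal dominant sets, doors their facets that carry every color but k0. *)
Definition room s := dominant s && (#|s| == #|I|).
Definition almost_rainbow t := col @: t == [set~ k0].
Definition door t := [&& dominant t, #|t|.+1 == #|I| & almost_rainbow t].
Definition door_tips s := [set y in s | almost_rainbow (s :\ y)].

(** A door of a room that is not rainbow leaves out a point whose color occurs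
    again in the room, and swapping these two points gives the only other
    door. *)
Lemma even_door_tips s :
  #|s| = #|I| -> col @: s != setT -> ~~ odd #|door_tips s|.
Proof.
move=> cs ns; have [->|[y]] := set_0Vmem (door_tips s); first by rewrite cards0.
rewrite [y \in _]in_set => /andP[ys /eqP E].
have sy : #|s :\ y|.+1 = #|I| by rewrite -cs (cardsD1 y s) ys.
have /imset_injP inj : #|col @: (s :\ y)| == #|s :\ y|.
  by rewrite E cardsC1 -sy.
have cyk : col y != k0.
  apply: contraNneq ns => cyk; rewrite -(setD1K ys) imsetU1 E cyk.
  by apply/eqP/setP => z; rewrite !inE orbN.
have /imsetP[y' y's cyy'] : col y \in col @: (s :\ y) by rewrite E !inE.
have yy' : y != y' by move: y's; rewrite !inE eq_sym => /andP[].
suff -> : door_tips s = [set y; y'] by rewrite cards2 yy'.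
apply/setP => z; rewrite [LHS]in_set in_set2; apply/andP/orP.
  move=> [zs /eqP Ez]; apply/orP; apply: contraT; rewrite negb_or => /andP[zy zy'].
  have /imset_injP injz : #|col @: (s :\ z)| == #|s :\ z|.
    by rewrite Ez cardsC1 -cs (cardsD1 z s) zs.
  have /injz : y \in s :\ z by rewrite !inE eq_sym zy.
  move=> /(_ y'); rewrite !inE eq_sym zy' (subsetP (subD1set s y)) // => /(_ isT cyy') E'.
  by rewrite E' eqxx in yy'.
case=> /eqP->; first by rewrite ys /almost_rainbow E.
have y's' : y' \in s by apply: (subsetP (subD1set s y)).
split=> //; rewrite /almost_rainbow -E eqEsubset; apply/andP; split.
  apply/subsetP => w /imsetP[x]; rewrite !inE => /andP[xy' xs] ->.
  have [->|xy] := eqVneq x y; first by rewrite cyy' imset_f.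
  by rewrite imset_f // !inE xy.
apply/subsetP => w /imsetP[x]; rewrite !inE => /andP[xy xs] ->.
have [->|xy'] := eqVneq x y'; last by rewrite imset_f // !inE xy'.
by rewrite -cyy' imset_f // !inE yy'.
Qed.

(** Both sides count the pairs of a room and one of its doors. *)
Lemma count_flags :
  \sum_(s | room s) #|door_tips s| = \sum_(t | door t) #|cofacets t|.
Proof.
under eq_bigr do rewrite -sum1_card; under [RHS]eq_bigr do rewrite -sum1_card.
rewrite !pair_big_dep /=.
rewrite (reindex_onto (fun p => (p.2 |: p.1, p.2)) (fun p => (p.1 :\ p.2, p.2))) /=.
  apply: eq_bigl => -[t y] /=; rewrite xpair_eqE eqxx andbT /room /door.
  rewrite [y \in door_tips _]in_set [y \in cofacets t]in_set setU11 /=.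
  have [yt|yt] := boolP (y \in t).
    rewrite /= andbF; apply/negbTE/nandP; right; apply/eqP => E.
    by have := setD11 y (y |: t); rewrite E yt.
  rewrite setU1K // eqxx cardsU1 yt andbT add1n.
  have [d|] := boolP (dominant (y |: t)); last by rewrite !andbF.
  by rewrite (dominantS (subsetUr _ _) d) /= andbT.
by move=> [s y] /= /andP[_]; rewrite [y \in door_tips _]in_set => /andP[ys _]; rewrite setD1K.
Qed.

(** If t0 is the only door to the outside, the number of pairs in
    [count_flags] is odd, so some room has an odd number of doors. *)
Lemma rainbow_room t0 :
    door t0 -> odd #|cofacets t0| ->
    (forall t, door t -> t != t0 -> ~~ odd #|cofacets t|) ->
  exists s, [/\ dominant s, #|s| = #|I| & col @: s = setT].
Proof.
move=> d0 o0 ev.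
have oddsum (J : finType) (P : pred J) (F : J -> nat) :
    odd (\sum_(j | P j) F j) = \big[addb/false]_(j | P j) odd (F j).
  exact: (big_morph odd oddD).
have : odd (\sum_(s | room s) #|door_tips s|).
  rewrite count_flags oddsum (bigD1 t0) //= o0 big1 // => t /andP[dt tt0].
  exact/negbTE/ev.
rewrite oddsum => o; suff /existsP[s /andP[/andP[ds /eqP cs] /eqP rs]] :
  [exists s, room s && (col @: s == setT)] by exists s.
apply: contraTT o => /existsPn H; rewrite big1 // => s rs; apply/negbTE.
have := H s; rewrite rs /= => ns.
by case/andP: rs => _ /eqP cs; apply: even_door_tips.
Qed.

End Pivot.

(** * Scarf's lemma *)

Lemma leq_lex m a b u v : v < m -> a * m + u <= b * m + v -> a <= b.
Proof.
move=> vm le; have m0 : 0 < m by apply: leq_trans vm.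
rewrite -ltnS -(ltn_pmul2r m0) mulSn addnC.
apply: leq_ltn_trans (leq_trans (leq_addr u _) le) _.
by rewrite ltn_add2l.
Qed.

Section Scarf.
Variables (X I : finType) (g : I -> X -> nat) (c : X -> I).

Definition slack_top i := ((\max_x g i x).+1 * #|X|).+1.

(** Adding one slack element [inr i] for each index i lets dominant sets of any size
    be completed to exactly #|I| elements. The slack i is lowest for its own
    index, so that it neutralizes that index, and above all of X for the
    others. Elements of X are ranked by g i, ties being broken by the
    enumeration of X. *)
Definition slack_rank i (y : X + I) : nat :=
  match y with
  | inl x => (g i x * #|X| + enum_rank x).+1
  | inr j => if j == i then 0 else slack_top i + enum_rank j
  end.

Lemma slack_rank_lt i j x : j != i -> slack_rank i (inl x) < slack_rank i (inr j).
Proof.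
move=> /negbTE /= ->; rewrite /slack_top addSn !ltnS.
apply: leq_trans (leq_addr _ _); rewrite mulSn [#|X| + _]addnC -addnS.
by rewrite leq_add ?ltn_ord // leq_mul2r leq_bigmax orbT.
Qed.

Lemma slack_rank_self i : slack_rank i (inr i) = 0.
Proof. by rewrite /= eqxx. Qed.

Lemma slack_rank_le i x y : slack_rank i (inl x) <= slack_rank i (inl y) -> g i x <= g i y.
Proof. by apply: leq_lex; apply: ltn_ord. Qed.

Lemma slack_rank_inj i : injective (slack_rank i).
Proof.
move=> [x|j] [x'|j'] E.
- have /eqP gE : g i x == g i x' by rewrite eqn_leq !slack_rank_le ?E.
  by move: E => /= [] /eqP; rewrite gE eqn_add2l => /eqP/val_inj/enum_rank_inj ->.
- have [ji|ji] := eqVneq j' i; first by move: E => /=; rewrite ji eqxx.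
  by have := slack_rank_lt x ji; rewrite E ltnn.
- have [ji|ji] := eqVneq j i; first by move: E => /=; rewrite ji eqxx.
  by have := slack_rank_lt x' ji; rewrite -E ltnn.
- move: E => /=; case: eqVneq => [->|_]; case: eqVneq => [->|_] //.
  by move/eqP; rewrite eqn_add2l => /eqP/val_inj/enum_rank_inj ->.
Qed.

Definition slack_color (y : X + I) : I := match y with inl x => c x | inr j => j end.

Local Notation dom := (dominant slack_rank).

(** Slack elements satisfy the dominance condition for free, through the index for
    which they are lowest. *)
Lemma slack_dominantP (s : {set X + I}) :
  reflect (forall x, exists i, forall y, y \in s -> slack_rank i (inl x) <= slack_rank i y)
          (dom s).
Proof.
apply: (iffP (dominantP _ _)) => H; first by move=> x; apply: H.
case=> [x|j]; first exact: H.
by exists j => y _; rewrite slack_rank_self.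
Qed.

(** The door to the outside. *)
Definition slack_door (k0 : I) : {set X + I} := inr @: [set~ k0].

Lemma door_slack k0 : door slack_rank slack_color k0 (slack_door k0).
Proof.
apply/and3P; split.
- apply/slack_dominantP => x; exists k0 => y /imsetP[j]; rewrite !inE => jk ->.
  exact/ltnW/slack_rank_lt.
- rewrite card_imset; last by move=> i j [].
  by rewrite cardsC1 prednK //; apply/card_gt0P; exists k0.
- apply/eqP; rewrite -imset_comp -[RHS]imset_id; exact: eq_imset.
Qed.

(** In presence of all slacks but k0, only the k0 ranking compares points of X,
    so the only completion is by its maximum. The remaining candidate, the
    slack k0, does not qualify: any x0 in X exceeds the minimum of the set of all
    slacks in every ranking. *)
Lemma card_cofacets_slack (x0 : X) k0 : #|cofacets slack_rank (slack_door k0)| = 1.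
Proof.
have [xm _ xmax] := @arg_maxnP X x0 predT (fun x => slack_rank k0 (inl x)) isT.
apply/eqP/cards1P; exists (inl xm); apply/setP => y; rewrite in_set in_set1.
apply/andP/eqP => [[yt /slack_dominantP dy]|->]; last first.
  split; first by apply/imsetP => -[].
  apply/slack_dominantP => x; exists k0 => y'; rewrite in_setU1 => /orP[/eqP->|].
    exact: xmax.
  by move=> /imsetP[j]; rewrite !inE => jk ->; apply/ltnW/slack_rank_lt.
have yk i : i != k0 -> inr i \in slack_door k0 by move=> ik; apply: imset_f; rewrite !inE.
case: y yt dy => [x _ dy|j]; last first.
  have [-> _ dy|/yk->//] := eqVneq j k0.
  have [i Hi] := dy x0; have := Hi (inr i); rewrite slack_rank_self in_setU1.
  suff -> : (inr i == inr k0 :> X + I) || (inr i \in slack_door k0) by move/(_ isT).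
  by have [->|/yk->] := eqVneq i k0; rewrite ?eqxx ?orbT.
have [i Hi] := dy xm.
have ik : i = k0.
  apply/eqP; apply: contraT => /yk ik.
  by have := Hi (inr i); rewrite slack_rank_self in_setU1 ik orbT => /(_ isT).
apply: (@slack_rank_inj k0); apply/eqP; rewrite eqn_leq; apply/andP; split.
  exact: xmax.
by rewrite -ik; apply: Hi; rewrite setU11.
Qed.

(** Any other door contains a point x of X, and then the slack e lies above x
    for every index but e: there is a candidate for each index. *)
Lemma card_cofacets_other k0 t :
    door slack_rank slack_color k0 t -> t != slack_door k0 ->
  #|cofacets slack_rank t| = 2.
Proof.
move=> /and3P[dt /eqP ct /eqP colt] tt0.
have /existsP[x xt] : [exists x, inl x \in t].
  apply: contraNT tt0 => /existsPn nx; apply/eqP/setP => -[x|j].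
    rewrite (negbTE (nx x)); apply/esym/negbTE; apply/imsetP => -[] //.
  rewrite mem_imset; last by move=> i i' [].
  rewrite -colt; apply/idP/imsetP => [jt|[[x|j'] yt]]; first by exists (inr j).
    by rewrite (negbTE (nx x)) in yt.
  by move=> /= ->.
apply: (card_cofacets_interior slack_rank_inj xt dt ct) => e.
apply/set0Pn; exists (inr e); apply/aboveP => j je.
by apply: leq_ltn_trans (order_min_le _ xt _ xt) (slack_rank_lt _ _); rewrite eq_sym.
Qed.

(** C is the set of indices whose slack is absent from a rainbow room: those are the
    colors and the rankings that the points of X in the room must account
    for. *)
Theorem scarf (x0 : X) : exists (C : {set I}) (s : I -> X),
  (forall k, k \in C -> c (s k) = k) /\
  (forall x, exists2 i, i \in C & forall k, k \in C -> g i x <= g i (s k)).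
Proof.
have [t [/slack_dominantP dt _ colt]] : exists s, [/\ dom s, #|s| = #|I| & slack_color @: s = setT].
  apply: (rainbow_room (door_slack (c x0))).
    by rewrite (card_cofacets_slack x0).
  by move=> t dt tt0; rewrite (card_cofacets_other dt tt0).
pose C := [set i | inr i \notin t].
have ex k : exists x, (k \in C) ==> (inl x \in t) && (c x == k).
  have [kC|] := boolP (k \in C); last by exists x0.
  have /imsetP[[x|j] yt kE] : k \in slack_color @: t by rewrite colt.
    by exists x; rewrite yt kE eqxx.
  by move: kC; rewrite inE kE yt.
exists C, (fun k => xchoose (ex k)); split=> [k kC|x].
  by have /implyP/(_ kC)/andP[_ /eqP] := xchooseP (ex k).
have [i Hi] := dt x; exists i.
  by rewrite inE; apply/negP => /Hi; rewrite slack_rank_self.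
move=> k kC; apply/slack_rank_le/Hi.
by have /implyP/(_ kC)/andP[] := xchooseP (ex k).
Qed.
End Scarf.

(** * Clusters of grid points *)

(** Let m i be the minimum over k in C of the i-th coordinate of s k for i in C,
    and 0 for the other i. If the
    sum of the m i + 1 over C were at most N, one could build a grid point whose
    coordinates on C all exceed m, against dominance. Hence the m i sum to at
    least N minus n+1, which leaves each s k at most n+1 units above m. *)
Lemma grid_cluster n N (c : {ffun 'I_n.+1 -> 'I_N.+1} -> 'I_n.+1) :
  exists (C : {set 'I_n.+1}) (s : 'I_n.+1 -> {ffun 'I_n.+1 -> 'I_N.+1}),
  [/\ C != set0,
      forall k, k \in C -> \sum_i s k i = N /\ c (s k) = k,
      forall k j, k \in C -> j \notin C -> s k j <= n.+1 &
      forall k l i, k \in C -> l \in C -> s k i <= s l i + n.+1].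
Proof.
pose X := {a : {ffun 'I_n.+1 -> 'I_N.+1} | \sum_i a i == N}.
pose mk (y : 'I_n.+1 -> nat) : {ffun 'I_n.+1 -> 'I_N.+1} := [ffun i => inord (y i)].
have mkE (y : 'I_n.+1 -> nat) : \sum_i y i = N -> forall i, mk y i = y i :> nat.
  by move=> yN i; rewrite ffunE inordK // ltnS -yN (bigD1 i) //= leq_addr.
have mkX (y : 'I_n.+1 -> nat) : \sum_i y i = N -> \sum_i mk y i == N.
  by move=> yN; rewrite -[X in _ == X]yN; apply/eqP/eq_bigr => i _; rewrite mkE.
have sum1 (j : 'I_n.+1) (K : nat) : \sum_i (if i == j then K else 0) = K.
  by rewrite -big_mkcond /= big_pred1_eq.
have y0N := sum1 ord0 N.
pose pt y (yN : \sum_(i < n.+1) y i = N) : X := Sub (mk y) (mkX y yN).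
have [C [s [sc dom]]] :=
  scarf (fun i (x : X) => val x i : nat) (fun x : X => c (val x)) (pt _ y0N).
have sN k : \sum_i val (s k) i = N by apply/eqP/(valP (s k)).
pose v (k i : 'I_n.+1) : nat := val (s k) i.
have [i0 i0C _] := dom (pt _ y0N).
pose w i := [arg min_(k < i0 in C) v k i].
have wC i : w i \in C by rewrite /w; case: arg_minnP.
have w_min i k : k \in C -> v (w i) i <= v k i.
  by rewrite /w; case: arg_minnP => // j _; apply.
pose m i : nat := if i \in C then v (w i) i else 0.
have m_le i k : k \in C -> m i <= v k i.
  by rewrite /m; case: ifP => // _; apply: w_min.
have m_sum : N <= \sum_i m i + n.+1.
  pose y1 i := if i \in C then (m i).+1 else 0.
  have y1_le : \sum_i y1 i <= \sum_i m i + n.+1.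
    have E : \sum_(i < n.+1) 1 = n.+1 by rewrite sum1_card card_ord.
    rewrite -[X in _ + X]E -big_split /=.
    by apply: leq_sum => i _; rewrite /y1; case: ifP; rewrite ?addn1.
  apply: leq_trans y1_le; rewrite leqNgt; apply/negP => lt.
  (* the missing mass is put on an arbitrary index of C *)
  pose y i := y1 i + (if i == i0 then N - \sum_i y1 i else 0).
  have yN : \sum_i y i = N.
    by rewrite big_split /= sum1 subnKC // ltnW.
  have [i iC] := dom (pt _ yN).
  move=> /(_ _ (wC i)) /=; rewrite mkE // leqNgt => /negP; apply.
  by rewrite /y /y1 iC /m iC addSn ltnS leq_addr.
have close k i : k \in C -> v k i <= m i + n.+1.
  move=> kC; have lek : \sum_(j | j != i) m j <= \sum_(j | j != i) v k j.
    by apply: leq_sum => j _; apply: m_le.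
  have : \sum_i v k i <= \sum_i m i + n.+1 by rewrite sN.
  rewrite (bigD1 i) //= [in leqRHS](bigD1 i) //= -addnA [_ + n.+1]addnC addnA => le.
  by rewrite -(leq_add2r (\sum_(j | j != i) v k j)) (leq_trans le) // leq_add2l.
exists C, (fun k => val (s k)); split.
- by apply/set0Pn; exists i0.
- by move=> k kC; rewrite sN sc.
- by move=> k j kC jC; have := close k j kC; rewrite /m (negbTE jC).
- by move=> k l i kC lC; apply: leq_trans (close k i kC) _; rewrite leq_add2r m_le.
Qed.

Import classical_sets.
Import Order.TTheory GRing.Theory Num.Theory.
Import numFieldNormedType.Exports.
Local Open Scope classical_set_scope.
Local Open Scope ring_scope.

(** * Barycentric weights *)

Section Hull.
Variables (R : realType) (d : nat).
Implicit Types (A F S : set 'rV[R]_d).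

Definition weights k (J : {set 'I_k}) (w : 'I_k -> R) :=
  [/\ forall i, 0 <= w i, forall i, i \notin J -> w i = 0 & \sum_i w i = 1].

Lemma convex_set_comb A (a b : 'rV[R]_d) (t : R) : convex_set A -> A a -> A b ->
  0 <= t -> t <= 1 -> A (t *: a + (1 - t) *: b).
Proof.
move=> cA Aa Ab t0 t1; have := cA a b (Itv01 t0 t1).
by rewrite !in_setE; apply.
Qed.

(** A weighted sum is handled as a point of the cone over A, which is stable
    under addition; this spares renormalizing partial sums. *)
Lemma convex_set_sum k (q : 'I_k -> 'rV[R]_d) A (w : 'I_k -> R) :
  convex_set A -> (forall i, 0 <= w i) -> (forall i, w i != 0 -> A (q i)) ->
  \sum_i w i = 1 -> A (\sum_i w i *: q i).
Proof.
move=> cA w0 wA w1.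
pose K (s : R) (v : 'rV[R]_d) := s = 0 /\ v = 0 \/ 0 < s /\ A (s^-1 *: v).
suff : K (\sum_i w i) (\sum_i w i *: q i).
  by rewrite /K w1 invr1 scale1r => -[[/eqP]|[]//]; rewrite oner_eq0.
apply: (big_ind2 K); first by left.
- move=> s v s' v' [[-> ->]|[s0 As]]; first by rewrite !add0r.
  case=> [[-> ->]|[s'0 As']]; first by rewrite !addr0; right.
  have ss0 : 0 < s + s' by apply: addr_gt0.
  right; split=> //; rewrite (_ : _ *: _ =
      (s / (s + s')) *: (s^-1 *: v) + (1 - s / (s + s')) *: (s'^-1 *: v')).
    apply: convex_set_comb => //; first by rewrite divr_ge0 ?ltW.
    by rewrite ler_pdivrMr // mul1r lerDl ltW.
  rewrite scalerDr !scalerA; congr (_ *: _ + _ *: _).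
    by rewrite mulrAC divff ?lt0r_neq0 // mul1r.
  rewrite -[X in X - _](divff (lt0r_neq0 ss0)) -mulrBl addrAC subrr add0r.
  by rewrite mulrAC divff ?lt0r_neq0 // mul1r.
- move=> i _; have [->|wi] := eqVneq (w i) 0; first by left; rewrite scale0r.
  right; split; first by rewrite lt0r wi w0.
  by rewrite scalerA mulVf // scale1r; apply: wA.
Qed.

Lemma spanned_faceP k (q : 'I_k -> 'rV[R]_d) (J : {set 'I_k}) x :
  spanned_face q J x <-> exists2 w, weights J w & x = \sum_i w i *: q i.
Proof.
split; last first.
  move=> [w [w0 wJ w1] ->] A [cA qA]; apply: convex_set_sum => // i wi.
  apply: qA; exists i => //=; apply: contraT => iJ.
  by rewrite wJ // eqxx in wi.
pose B : set 'rV[R]_d := [set x | exists2 w, weights J w & x = \sum_i w i *: q i].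
move: x; change (spanned_face q J `<=` B); apply: smallest_sub.
  move=> a b t; rewrite !in_setE; set s := t%:num.
  change (B a -> B b -> B (s *: (a : 'rV[R]_d) + (1 - s) *: (b : 'rV[R]_d))).
  move=> [u [u0 uJ u1] ->] [v [v0 vJ v1] ->].
  have s0 : 0 <= s by apply: (ge0 t).
  have s1 : 0 <= 1 - s by rewrite subr_ge0; apply: (le1 t).
  exists (fun i => s * u i + (1 - s) * v i).
    split=> [i|i iJ|]; first by rewrite addr_ge0 ?mulr_ge0.
      by rewrite uJ // vJ // !mulr0 addr0.
    by rewrite big_split -!mulr_sumr /= u1 v1 !mulr1 addrC subrK.
  rewrite !scaler_sumr -big_split; apply: eq_bigr => i _ /=.
  by rewrite [RHS]scalerDl !scalerA.
move=> _ [j jJ <-]; exists (fun i => (i == j)%:R).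
  split=> [i|i|]; first by rewrite ler0n.
    by case: eqVneq => // -> /negP.
  by rewrite (bigD1 j) //= eqxx big1 ?addr0 // => i /negbTE->.
rewrite (bigD1 j) //= eqxx scale1r big1 ?addr0 // => i /negbTE->.
by rewrite scale0r.
Qed.

Lemma hull_range k (q : 'I_k -> 'rV[R]_d) :
  convex_hull (range q) = spanned_face q [set: 'I_k]%SET.
Proof.
by congr (convex_hull (_ @` _)); apply/seteqP; split=> i // _; apply: finset.in_setT.
Qed.

Lemma spanned_faceS k (q : 'I_k -> 'rV[R]_d) (J J' : {set 'I_k}) :
  J \subset J' -> spanned_face q J `<=` spanned_face q J'.
Proof.
move=> /fintype.subsetP JJ' x /spanned_faceP[w [w0 wJ w1] ->]; apply/spanned_faceP.
by exists w => //; split=> // i iJ'; apply: wJ; apply: contra iJ' => /JJ'.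
Qed.

Lemma affinely_independent_inj k (q : 'I_k -> 'rV[R]_d) (J J' : {set 'I_k}) u v :
  affinely_independent q -> weights J u -> weights J' v ->
  \sum_i u i *: q i = \sum_i v i *: q i -> u =1 v.
Proof.
move=> aq [_ _ u1] [_ _ v1] E i; apply/eqP; rewrite -subr_eq0; apply/eqP.
apply: (aq (fun i => u i - v i)); first by rewrite sumrB u1 v1 subrr.
by under eq_bigr do rewrite scalerBl; rewrite sumrB E subrr.
Qed.

(** By uniqueness of weights, a weight that vanishes in a convex combination
    vanishes in each of its terms. *)
Lemma face_extreme k (q : 'I_k -> 'rV[R]_d) (J : {set 'I_k}) a b (t : R) :
  affinely_independent q -> 0 < t -> t <= 1 ->
  convex_hull (range q) a -> convex_hull (range q) b ->
  spanned_face q J (t *: a + (1 - t) *: b) -> spanned_face q J a.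
Proof.
move=> aq t0 t1; rewrite hull_range.
move=> /spanned_faceP[u [u0 _ u1] ->] /spanned_faceP[v [v0 _ v1] ->].
have t1' : 0 <= 1 - t by rewrite subr_ge0.
move=> /spanned_faceP[w wJ E]; apply/spanned_faceP; exists u => //; split=> // i iJ.
have wtE : w =1 (fun i => t * u i + (1 - t) * v i).
  apply: (affinely_independent_inj aq wJ (J' := [set: 'I_k]%SET)).
    split=> [j|j|]; first by rewrite addr_ge0 ?mulr_ge0 // ltW.
      by rewrite finset.in_setT.
    by rewrite big_split -!mulr_sumr /= u1 v1 !mulr1 addrC subrK.
  rewrite -E !scaler_sumr -big_split; apply: eq_bigr => j _ /=.
  by rewrite [RHS]scalerDl !scalerA.
case: wJ => _ /(_ i iJ) wi _; move/eqP: (wtE i).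
rewrite wi eq_sym paddr_eq0 ?mulr_ge0 ?u0 ?v0 ?(ltW t0) // => /andP[+ _].
by rewrite mulf_eq0 (gt_eqF t0) => /eqP.
Qed.

Lemma is_face_extreme F S a b (t : R) : is_face F S -> 0 < t -> t <= 1 ->
  S a -> S b -> F (t *: a + (1 - t) *: b) -> F a.
Proof. by move=> [k [q [J [aq -> _ ->]]]]; apply: face_extreme. Qed.

Lemma hull_vertex k (q : 'I_k -> 'rV[R]_d) j : convex_hull (range q) (q j).
Proof. by apply: sub_gen_smallest; exists j. Qed.

(** Some vertex has a positive weight in x. *)
Lemma vertex_support k (q : 'I_k -> 'rV[R]_d) x : convex_hull (range q) x ->
  exists j y (t : R), [/\ 0 < t, t <= 1, convex_hull (range q) y &
                        x = t *: q j + (1 - t) *: y].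
Proof.
move=> qx; have [w [w0 _ w1] ->] : exists2 w, weights [set: 'I_k]%SET w & x = \sum_i w i *: q i.
  by apply/spanned_faceP; rewrite -hull_range.
have [j wj] : exists j, 0 < w j.
  apply: contrapT => /forallNP H; move: w1; rewrite big1 => [/esym/eqP|i _].
    by rewrite oner_eq0.
  by apply/eqP; rewrite eq_le w0 andbT leNgt; apply/negP.
have wj1 : w j <= 1 by rewrite -w1 (bigD1 j) //= lerDl sumr_ge0.
(* half of the weight is split off, so that 1 - t is nonzero even for x = q j *)
pose t := w j / 2; have t0 : 0 < t by rewrite divr_gt0.
have tw : t <= w j by rewrite ler_pdivrMr // ler_peMr ?w0 // ler1n.
have t1 : t < 1 by rewrite ltr_pdivrMr // mul1r (le_lt_trans wj1) // ltr1n.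
have t1' : 0 < 1 - t by rewrite subr_gt0.
pose v i := (w i - (i == j)%:R * t) / (1 - t).
have sum_j (V : lmodType R) (f : 'I_k -> V) : \sum_i (i == j)%:R *: f i = f j.
  by rewrite (bigD1 j) //= eqxx scale1r big1 ?addr0 // => i /negbTE->; rewrite scale0r.
exists j, (\sum_i v i *: q i), t; split=> //; first exact: ltW.
  rewrite hull_range; apply/spanned_faceP; exists v => //; split=> [i|i|].
  - rewrite divr_ge0 ?(ltW t1') // subr_ge0.
    by case: eqVneq => [->|_]; rewrite ?mul1r ?mul0r.
  - by rewrite finset.in_setT.
  - by rewrite -mulr_suml sumrB w1 (sum_j R^o (fun=> t)) divff // gt_eqF.
rewrite -(sum_j _ (fun i => t *: q i)) scaler_sumr -big_split; apply: eq_bigr => i _ /=.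
by rewrite /v !scalerA -scalerDl [(1 - t) * _]mulrC divfK ?(gt_eqF t1') // addrC subrK.
Qed.
End Hull.

(** * Limits along an ultrafilter *)

Lemma ultra_pigeonhole D (E : eqType) (U : set_system D) (g : D -> E) (s : seq E) :
  UltraFilter U -> U [set x | g x \in s] ->
  exists2 e, e \in s & U [set x | g x = e].
Proof.
move=> UU; elim: s => [|e s IHs] Us.
  by have [x] := filter_ex Us.
have [Ue|Une] := in_ultra_setVsetC [set x | g x = e] UU.
  by exists e; rewrite ?mem_head.
have [|e' e's Ue'] := IHs; last by exists e'; rewrite // inE e's orbT.
apply: filterS (filterI Us Une) => x /= [].
by rewrite inE => /orP[/eqP|].
Qed.

Section UltraLimit.
Variables (R : realType) (D : Type) (U : set_system D).
Hypothesis UU : UltraFilter U.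

Lemma ultra_cvg01 (u : D -> R) : (forall x, 0 <= u x <= 1) -> exists l : R, u @ U --> l.
Proof.
move=> u01; have cpt := @segment_compact R 0 1.
have U01 : (u @ U) `[0, 1]%classic.
  suff : U [set x | u x \in `[0, 1]] by [].
  by apply: filterS filterT => x _; rewrite /= in_itv; apply: u01.
have [l [_ ul]] := cpt (u @ U) _ U01.
exists l => V Vl; have [//|UnV] := in_ultra_setVsetC (u @^-1` V) UU.
by have [y [nVy Vy]] := ul (~` V) V UnV Vl.
Qed.

Lemma cvg_sumr k (u : 'I_k -> D -> R) (l : 'I_k -> R) :
  (forall i, u i @ U --> l i) -> (fun x => \sum_i u i x) @ U --> \sum_i l i.
Proof.
move=> ul; apply: cvg_big => //; exact: add_continuous.
Qed.

Lemma cvg_unique_near (u v : D -> R) (a b : R) : u @ U --> a -> v @ U --> b ->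
  U [set x | u x = v x] -> a = b.
Proof.
move=> ua vb uv; apply: (@cvg_unique R (@norm_hausdorff _ _) (v @ U)) => //.
exact: cvg_trans (near_eq_cvg _) ua.
Qed.

(** Along an ultrafilter all weights converge simultaneously, with no
    extraction of subsequences. *)
Lemma hull_closed d k (q : 'I_k -> 'rV[R]_d) (x : D -> 'rV[R]_d) (y : 'rV[R]_d) :
  U [set N | convex_hull (range q) (x N)] ->
  (forall c, (fun N => x N 0 c) @ U --> y 0 c) ->
  convex_hull (range q) y.
Proof.
move=> Ux xy.
have /choice[w wP] N : exists w : 'I_k -> R, (forall j, 0 <= w j <= 1) /\
    (convex_hull (range q) (x N) -> \sum_j w j = 1 /\ x N = \sum_j w j *: q j).
  have [h|h] := pselect (convex_hull (range q) (x N)); last first.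
    by exists (fun=> 0); split=> // j; rewrite lexx ler01.
  move: (h); rewrite hull_range => /spanned_faceP[w [w0 _ w1] xE].
  exists w; split=> // j; rewrite w0 -w1 (bigD1 j) //= lerDl sumr_ge0 //.
have /choice[om omP] j : exists l : R, (fun N => w N j) @ U --> l.
  by apply: ultra_cvg01 => N; have [] := wP N.
rewrite hull_range; apply/spanned_faceP; exists om.
  split=> [j|j|]; last 1 first.
  - have c1 : (fun=> 1 : R) @ U --> (1 : R) by apply: cvg_cst.
    apply: cvg_unique_near (cvg_sumr omP) c1 _.
    by apply: filterS Ux => N; have [_] := wP N; move=> /[apply] -[].
  - by apply: (cvgr_to_ge (omP j)); apply: nearW => N; have [/(_ j)/andP[]] := wP N.
  - by rewrite finset.in_setT.
apply/rowP => c; rewrite summxE.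
under eq_bigr do rewrite mxE.
apply: (cvg_unique_near (xy c)).
  by apply: cvg_sumr => j; apply: cvgMr_tmp; apply: omP.
apply: filterS Ux => N; have [_] := wP N; move=> /[apply] -[_ /= ->].
by rewrite summxE; apply: eq_bigr => j _; rewrite mxE.
Qed.
End UltraLimit.

(** * Vertices of a geometric triangulation *)

Section Triangulation.
Variables (R : realType) (d : nat) (T : set (set 'rV[R]_d)) (D : set 'rV[R]_d).
Hypothesis TD : is_triangulation T D.

Lemma triangulation_vertex S k (q : 'I_k.+1 -> 'rV[R]_d) j :
  T S -> affinely_independent q -> S = convex_hull (range q) -> T [set q j].
Proof.
move=> TS aq SE; have [_ _ _ faceT _] := TD; apply: (faceT S) => //.
exists k, q, [set j]%SET; split; rewrite ?cards1 //.
apply/seteqP; split=> [_ ->|x].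
  by apply: sub_gen_smallest; exists j; rewrite //= finset.in_set1.
move=> /spanned_faceP[w [w0 wJ w1] ->] /=.
have wi i : i != j -> w i = 0 by move=> ij; rewrite wJ // finset.in_set1.
rewrite (bigD1 j) //= big1 => [|i /wi ->]; last by rewrite scale0r.
move: w1; rewrite (bigD1 j) //= big1 => [|i /wi //].
by rewrite !addr0 => ->; rewrite scale1r.
Qed.

(** Distinct simplices meet in a face, so v is a face of S, hence an extreme
    point of S; and an extreme point of a hull is one of its generators. *)
Lemma vertex_in_simplex S k (q : 'I_k.+1 -> 'rV[R]_d) v :
  T S -> S = convex_hull (range q) -> T [set v] -> S v -> exists j, v = q j.
Proof.
move=> TS SE Tv Sv.
have ext a b (t : R) : 0 < t -> t <= 1 -> S a -> S b -> v = t *: a + (1 - t) *: b -> a = v.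
  move=> t0 t1 Sa Sb vE; have [Sv1|Sv1] := pselect (S = [set v]).
    by move: Sa; rewrite Sv1.
  have [_ _ _ _ inter] := TD; have [|[+ _]] := inter S [set v] TS Tv Sv1.
    by move/seteqP => [/(_ v)]; case.
  move=> face; have [] // := is_face_extreme face t0 t1 Sa Sb.
  by rewrite -vE.
have [j [y [t [t0 t1 Sy vE]]]] : exists j y (t : R), [/\ 0 < t, t <= 1, S y &
    v = t *: q j + (1 - t) *: y].
  by rewrite SE; apply: vertex_support; rewrite -SE.
exists j; rewrite (ext _ _ _ t0 t1 _ Sy vE) // SE; exact: hull_vertex.
Qed.

(** Take for v a vertex of S with positive weight in x. If S' also contains x,
    then x lies in the face that S and S' share; faces being extreme, v
    lies in it as well. *)
Lemma common_support S x : T S -> S x ->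
  exists v y (t : R), [/\ 0 < t, t <= 1, S y & x = t *: v + (1 - t) *: y] /\
    [/\ T [set v], S v & forall S', T S' -> S' x -> S' v].
Proof.
move=> TS Sx; have [_ simp _ faceT inter] := TD.
have [k [q [aq SE]]] := simp S TS.
have [j [y [t [t0 t1 Sy xE]]]] : exists j y (t : R), [/\ 0 < t, t <= 1, S y &
    x = t *: q j + (1 - t) *: y].
  by rewrite SE; apply: vertex_support; rewrite -SE.
have Sq : S (q j) by rewrite SE; apply: hull_vertex.
exists (q j), y, t; split; split=> //; first exact: triangulation_vertex aq SE.
move=> S' TS' S'x; have [<-//|SS'] := pselect (S = S').
have [/seteqP[/(_ x)]|[face _]] := inter S S' TS TS' SS'; first by case.
by have [] // := is_face_extreme face t0 t1 Sq Sy; rewrite -xE.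
Qed.
End Triangulation.

(** * Sperner's lemma *)

Section Sperner.
Variables (R : realType) (d n : nat) (p : 'I_n.+1 -> 'rV[R]_d).

Definition grid_point N (a : {ffun 'I_n.+1 -> 'I_N.+1}) : 'rV[R]_d :=
  \sum_i ((a i)%:R / N%:R) *: p i.

Lemma grid_point_hull N (a : {ffun 'I_n.+1 -> 'I_N.+2}) :
  (\sum_i a i)%N = N.+1 -> convex_hull (range p) (grid_point a).
Proof.
move=> aN; rewrite hull_range; apply/spanned_faceP.
exists (fun i => (a i)%:R / N.+1%:R) => //; split=> [i|i|].
- by rewrite divr_ge0.
- by rewrite finset.in_setT.
- by rewrite -mulr_suml -natr_sum aN divff ?pnatr_eq0.
Qed.

(** Coordinates of the grid points differ from each other, and off C from 0, by
    at most (n+1)/(N+1), so all the sequences indexed by C have the same limit,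
    and it lies in the face C. *)
Lemma sperner_limit (C : nat -> {set 'I_n.+1})
    (s : forall N, 'I_n.+1 -> {ffun 'I_n.+1 -> 'I_N.+2}) (U : set_system nat) :
  UltraFilter U -> \oo `<=` U ->
  (forall N, [/\ C N != finset.set0,
      forall k, k \in C N -> (\sum_i s N k i)%N = N.+1,
      forall k j, k \in C N -> j \notin C N -> (s N k j <= n.+1)%N &
      forall k l i, k \in C N -> l \in C N -> (s N k i <= s N l i + n.+1)%N]) ->
  exists (C0 : {set 'I_n.+1}) x,
    [/\ U [set N | C N = C0], C0 != finset.set0, spanned_face p C0 x &
      forall k, k \in C0 -> forall c, (fun N => grid_point (s N k) 0 c) @ U --> x 0 c].
Proof.
move=> UU ooU H.
have [C0 _ UC0] : exists2 e, e \in enum {set 'I_n.+1} & U [set N | C N = e].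
  by apply: ultra_pigeonhole; apply: filterS filterT => N _ /=; rewrite mem_enum.
have C0n0 : C0 != finset.set0 by have [N <-] := filter_ex UC0; have [] := H N.
have [/finset.set0Pn[k0 k0C]] := C0n0.
pose u k i N : R := (s N k i)%:R / N.+1%:R.
pose h N : R := n.+1%:R / N.+1%:R.
have h0 : h @ U --> (0 : R).
  have : h @ \oo --> (0 : R).
    have -> : h = (fun N => n.+1%:R * harmonic N) by apply/funext.
    rewrite -(mulr0 n.+1%:R); apply: cvgMl_tmp; exact: cvg_harmonic.
  by apply: cvg_trans; apply: cvg_app.
have u01 k i N : 0 <= u k i N <= 1.
  by rewrite divr_ge0 //= ler_pdivrMr // mul1r ler_nat -ltnS ltn_ord.
have /choice[al alP] i : exists l : R, u k0 i @ U --> l by apply: ultra_cvg01.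
have u_close k l i N : C N = C0 -> k \in C0 -> l \in C0 -> u k i N <= u l i N + h N.
  move=> CN kC lC; rewrite -mulrDl ler_pM2r ?invr_gt0 // -natrD ler_nat.
  by have [_ _ _] := H N; rewrite CN; apply.
have uP k i : k \in C0 -> u k i @ U --> al i.
  move=> kC; apply: (@squeeze_cvgr _ _ _ _ (u k0 i - h) (u k0 i + h)).
  - apply: filterS UC0 => N CN; apply/andP; split; last exact: u_close.
    by rewrite /= lerBlDr; apply: u_close.
  - rewrite -[X in _ --> X]subr0; exact: cvgB.
  - rewrite -[X in _ --> X]addr0; exact: cvgD.
exists C0, (\sum_i al i *: p i); split=> //.
  apply/spanned_faceP; exists al => //; split=> [i|i iC|].
  - by apply: (cvgr_to_ge (alP i)); apply: nearW => N; have /andP[] := u01 k0 i N.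
  - apply/eqP; rewrite eq_le; apply/andP; split; last first.
      by apply: (cvgr_to_ge (alP i)); apply: nearW => N; have /andP[] := u01 k0 i N.
    apply: (ler_cvg_to (alP i) h0); apply: filterS UC0 => N CN.
    rewrite ler_pM2r ?invr_gt0 // ler_nat.
    by have [_ _ + _] := H N; rewrite CN; apply.
  - have c1 : (fun=> 1 : R) @ U --> (1 : R) by apply: cvg_cst.
    apply: (cvg_unique_near UU (cvg_sumr UU alP) c1).
    apply: filterS UC0 => N CN /=.
    have [_ + _ _] := H N; rewrite CN => /(_ k0 k0C) sN.
    by rewrite -mulr_suml -natr_sum sN divff ?pnatr_eq0.
move=> k kC c; rewrite summxE.
under eq_bigr do rewrite mxE.
have -> : (fun N => grid_point (s N k) 0 c) = (fun N => \sum_i u k i N * p i 0 c).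
  by apply/funext => N; rewrite summxE; apply: eq_bigr => i _; rewrite mxE.
by apply: cvg_sumr => i; apply: cvgMr_tmp; apply: uP.
Qed.

(** The hypothesis on l says that each vertex lies off the facet opposite to
    p (l v); this is equivalent to the more usual
    condition that p (l v) be a vertex of the smallest face containing v. *)
Theorem sperner (T : set (set 'rV[R]_d)) (l : 'rV[R]_d -> 'I_n.+1) :
  affinely_independent p -> is_triangulation T (convex_hull (range p)) ->
  (forall v, T [set v] -> ~ spanned_face p (~: [set l v])%SET v) ->
  exists2 S, T S & forall i, exists v, [/\ T [set v], S v & l v = i].
Proof.
move=> ap tri lP; apply: contrapT => /forall2NP H.
have [Tfin simp Tcov faceT _] := tri.
have miss S : exists i, T S -> forall v, T [set v] -> S v -> l v != i.
  have [//|/existsNP[i iP]] := H S; first by exists ord0.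
  exists i => _ v Tv Sv; apply/eqP => lv; apply: iP; by exists v.
have [m mP] := choice miss.
have cov x : exists S, convex_hull (range p) x -> T S /\ S x.
  have [|] := pselect (convex_hull (range p) x); last by exists setT.
  by rewrite -Tcov => -[S TS Sx]; exists S.
have [St StP] := choice cov.
pose lab N (a : {ffun 'I_n.+1 -> 'I_N.+2}) := m (St (grid_point a)).
have grid N := cid (grid_cluster (@lab N)).
pose C N := projT1 (grid N); have grid' N := cid (projT2 (grid N)).
pose s N := projT1 (grid' N).
have sP N : [/\ C N != finset.set0,
    forall k, k \in C N -> (\sum_i s N k i)%N = N.+1 /\ lab N (s N k) = k,
    forall k j, k \in C N -> j \notin C N -> (s N k j <= n.+1)%N &
    forall k l i, k \in C N -> l \in C N -> (s N k i <= s N l i + n.+1)%N] := projT2 (grid' N).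
have [U [UU ooU]] := ultraFilterLemma eventually_filter.
have [C0 [x [UC0 /finset.set0Pn[k0 k0C] xC0 sx]]] : exists (C0 : {set 'I_n.+1}) x,
    [/\ U [set N | C N = C0], C0 != finset.set0, spanned_face p C0 x &
      forall k, k \in C0 -> forall c, (fun N => grid_point (s N k) 0 c) @ U --> x 0 c].
  apply: sperner_limit => // N; have [? sNP ? ?] := sP N; split=> // k kC.
  by have [] := sNP k kC.
have [ts tsE] : exists ts : seq (set 'rV[R]_d), T = [set` ts] by apply/finite_seqP.
(* the limit x lies, for each k in C0, in a simplex without the label k *)
have near_simplex k : k \in C0 -> exists S, [/\ T S, S x & m S = k].
  move=> kC.
  have StS N : C N = C0 -> T (St (grid_point (s N k))) /\
      St (grid_point (s N k)) (grid_point (s N k)).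
    move=> CN; apply: StP; apply: grid_point_hull; have [_ + _ _] := sP N.
    by rewrite CN => /(_ k kC)[].
  have [S Sts US] : exists2 S, S \in ts & U [set N | St (grid_point (s N k)) = S].
    apply: ultra_pigeonhole; apply: filterS UC0 => N /StS[+ _] /=.
    by rewrite tsE.
  have TS : T S by rewrite tsE.
  exists S; split=> //; last first.
    have [N [CN <-]] := filter_ex (filterI UC0 US).
    by have [_ + _ _] := sP N; rewrite CN => /(_ k kC)[].
  have [j [q [_ SE]]] := simp S TS; rewrite SE; apply: (hull_closed UU _ (sx k kC)).
  apply: filterS (filterI UC0 US) => N [/StS[_ + ] /= SN].
  by rewrite SN SE.
have [S0 [TS0 S0x _]] := near_simplex k0 k0C.
have sub S v : T S -> S v -> convex_hull (range p) v by move=> TS Sv; rewrite -Tcov; exists S.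
have [v [y [t [[t0 t1 S0y xE] [Tv S0v vS]]]]] := common_support tri TS0 S0x.
have vC0 : spanned_face p C0 v.
  by apply: (face_extreme ap t0 t1 (sub _ _ TS0 S0v) (sub _ _ TS0 S0y)); rewrite -xE.
have lvC0 : l v \in C0.
  apply: contraT => lvC0; case: (lP v Tv); apply: spanned_faceS vC0.
  by rewrite finset.subsetC finset.sub1set finset.in_setC.
have [S [TS Sx mS]] := near_simplex _ lvC0.
by have := mP S TS v Tv (vS S TS Sx); rewrite mS eqxx.
Qed.
End Sperner.

(** * Components of the color classes *)

Section Component.
Variables (V : Type) (E : rel V).
Hypothesis E_sym : symmetric E.

Definition component (v : V) : set V := [set u | exists s, path E v s /\ last v s = u].

Lemma component_refl v : component v v.
Proof. by exists [::]. Qed.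

Lemma component_trans u v w : component u v -> component v w -> component u w.
Proof.
move=> [s [us <-]] [t [vt <-]]; exists (s ++ t).
by rewrite cat_path last_cat us vt.
Qed.

Lemma component_sym u v : component u v -> component v u.
Proof.
move=> [s [us <-]]; exists (rev (belast u s)); split.
  by rewrite rev_path; under eq_path do rewrite E_sym.
by case: s us => //= x s _; rewrite rev_cons last_rcons.
Qed.

Lemma component_edge u v : E u v -> component u v.
Proof. by move=> uv; exists [:: v]; rewrite /= uv. Qed.

Lemma eq_component u v : E u v -> component u = component v.
Proof.
move=> /component_edge uv; apply/seteqP; split=> w; apply: component_trans => //.
exact: component_sym.
Qed.

Definition component_rel v : rel V :=
  fun u w => [&& `[< component v u >], `[< component v w >] & E u w].

Lemma component_connected v : is_connected (component v) (component_rel v).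
Proof.
split; first by exists v; apply: component_refl.
move=> u w vu vw; have [s [us <-]] := component_trans (component_sym vu) vw.
exists s; split=> //; elim: s u us vu {vw} => //= x s IHs u /andP[ux xs] vu.
have vx : component v x := component_trans vu (component_edge ux).
by rewrite IHs // andbT; apply/and3P; split=> //; apply/asboolP.
Qed.

Lemma component_inv (P : V -> Prop) v u : (forall x y, E x y -> P x -> P y) ->
  component v u -> P v -> P u.
Proof.
move=> EP [s [+ <-]]; elim: s v => //= x s IHs v /andP[vx xs] /(EP _ _ vx).
exact: IHs.
Qed.
End Component.

Lemma triangulation_edge (R : realType) d (T : set (set 'rV[R]_d)) D S u v :
  is_triangulation T D -> T S -> T [set u] -> T [set v] -> S u -> S v -> u <> v ->
  edge T u v.
Proof.
move=> tri TS Tu Tv Su Sv uv; split=> //.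
have [_ simp _ faceT _] := tri; have [k [q [aq SE]]] := simp S TS.
have [a uE] := vertex_in_simplex tri TS SE Tu Su.
have [b vE] := vertex_in_simplex tri TS SE Tv Sv.
apply: (faceT S) => //; exists k, q, [set a; b]%SET; split=> //.
  by rewrite cards2.
congr convex_hull; rewrite uE vE; apply/seteqP; split.
  by move=> _ [->|->] /=; [exists a|exists b]; rewrite //= finset.in_set2 eqxx ?orbT.
by move=> _ [c /= + <-]; rewrite finset.in_set2 => /orP[/eqP->|/eqP->]; [left|right].
Qed.

Theorem theorem1p1 (R : realType) (d n : nat) (p : 'I_n.+1 -> 'rV[R]_d)
    (T : set (set 'rV[R]_d)) (f : 'rV[R]_d -> nat) :
  affinely_independent p ->
  is_triangulation T (convex_hull (range p)) ->
  set_fun (vertices T) [set c | (1 <= c <= n)%N] f ->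
  exists (W : set 'rV[R]_d) (F : rel 'rV[R]_d),
    [/\ is_subgraph (vertices T) (edge T) W F,
        is_connected W F,
        is_monochromatic f W &
        forall J : {set 'I_n.+1}, #|J| = n -> W `&` spanned_face p J !=set0].
Proof.
move=> ap tri fV.
(* adjacency in the 1-skeleton between vertices of the same color *)
pose E u v := `[< [/\ T [set u], T [set v], f u = f v & edge T u v] >].
have E_sym : symmetric E.
  move=> u v; apply/asboolP/asboolP => -[Tu Tv fuv [uv Tuv]]; split=> //; split.
  - by move=> vu; apply: uv.
  - by rewrite setUC.
  - by move=> vu; apply: uv.
  - by rewrite setUC.
apply: contrapT => noW.
(* m is a function of the component, so that vertices of one component get one label *)
have miss W : exists i, (exists2 v, T [set v] & W = component E v) ->
    W `&` spanned_face p (~: [set i])%SET = set0.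
  have [[v Tv ->]|] := pselect (exists2 v, T [set v] & W = component E v); last first.
    by exists ord0.
  have [J JP] : exists J : {set 'I_n.+1}, #|J| = n /\ component E v `&` spanned_face p J = set0.
    apply: contrapT => noJ; apply: noW; exists (component E v), (component_rel E v).
    have compT u : component E v u -> T [set u].
      by move=> vu; apply: (component_inv (P := fun u => T [set u]) _ vu Tv) => x y /asboolP[].
    split.
    - split=> [u|u w|u w /and3P[/asboolP vu /asboolP vw /asboolP[_ _ _ uw]]] //.
      + exact: compT.
      + by rewrite /component_rel E_sym andbCA.
    - exact: component_connected.
    - have fE u : component E v u -> f u = f v.
        move=> vu; apply: (component_inv (P := fun u => f u = f v) _ vu) => //.
        by move=> x y /asboolP[_ _ <-].
      by move=> u w vu vw; rewrite !fE.
    - move=> J cJ; apply/set0P/eqP => J0; apply: noJ; by exists J.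
  case: JP => cJ J0.
  have /cards1P[i iJ] : #|~: J|%SET == 1%N.
    by rewrite -(eqn_add2l #|J|) cardsC card_ord cJ addn1.
  by exists i => _; rewrite -iJ finset.setCK.
have [m mP] := choice miss.
pose l v := m (component E v).
have [|S TS rainbow] := sperner (l := l) ap tri.
  move=> v Tv vl; have : (set0 : set 'rV[R]_d) v; last by [].
  rewrite -(mP (component E v)); last by exists v.
  by split=> //; apply: component_refl.
have [w wP] := choice rainbow.
have w_lt i : ((f (w i)).-1 < n)%N.
  by have [/fV /= /andP[f0 fn] _ _] := wP i; rewrite prednK.
have /injectivePn[i [j ij [fij]]] : ~~ injectiveb (fun i => Ordinal (w_lt i)).
  by apply/injectiveP => /leq_card; rewrite !card_ord ltnn.
have [Ti Si li] := wP i; have [Tj Sj lj] := wP j.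
have fE : f (w i) = f (w j).
  have /andP[fi0 _] : (1 <= f (w i) <= n)%N := fV _ Ti.
  have /andP[fj0 _] : (1 <= f (w j) <= n)%N := fV _ Tj.
  by rewrite -(prednK fi0) fij prednK.
have wij : w i <> w j by move=> wE; case/eqP: ij; rewrite -li -lj wE.
case/eqP: ij; rewrite -li -lj /l; congr m; apply: eq_component => //.
apply/asboolP; split=> //; exact: (triangulation_edge tri TS).
Qed.
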